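(* Let $A$ be a real isotropic $d\times d$ dilation matrix, and let $M$ be the associated function defined in the context. Let $k\in\mathbb{Z}^d$ and $s\in S(A^T)\setminus\{0\}$. Then, for arbitrarily large $r>|2\pi(k+s)|$, there exists a point $\xi\in\mathbb{R}^d$ with $|\xi|>r$ such that $$M(\xi)=M(2\pi(k+s))>0.$$
   Context: A real isotropic dilation matrix is a $d\times d$ matrix $A$ with integer entries, all of whose eigenvalues are greater than $1$ in absolute value, which is diagonalizable over $\mathbb{C}$ and all of whose eigenvalues have equal absolute value. Put $q:=|\det A|$ and $A^{-T}:=(A^T)^{-1}$. One can factor $A^{-T}=q^{-1/d}Q^{-1}UQ$ with $U$ real orthogonal and $Q$ real symmetric positive definite; fix such a $Q$ and write $Q^2=(q_{ij})_{1\le i,j\le d}$. Define $$G(\xi):=4\sum_{i} q_{ii}\sin^2\frac{\xi_i}{2}+2\sum_{i<j}q_{ij}\sin\xi_i\sin\xi_j .$$ Let $S(A^T):=\{s\in[0,1)^d: A^Ts\in\mathbb{Z}^d\}$ (this set has $q$ elements and contains $0$), and define the mask $$m_0(\xi):=\prod_{s\in S(A^T)\setminus\{0\}}\frac{G(\xi+2\pi s)}{G(2\pi s)}.$$ Define $$\mu(\xi):=\frac{q^{2/d}\,m_0(A^{-T}\xi)\,G(A^{-T}\xi)}{G(\xi)},$$ where at the points of $2\pi\mathbb{Z}^d$ (zeros of $G$) the value is understood as the limit, and $M(\xi):=\prod_{j=0}^\infty\mu\bigl((A^{-T})^j\xi\bigr)$. *)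

(* Defs.v *)
From HB Require Import structures.
From mathcomp Require Import all_boot all_order all_algebra.
From mathcomp Require Import complex.
From mathcomp Require Import all_classical all_reals all_analysis.

Set Implicit Arguments.
Unset Strict Implicit.
Unset Printing Implicit Defensive.

Import Order.TTheory GRing.Theory Num.Theory.
Import numFieldNormedType.Exports.

Local Open Scope classical_set_scope.
Local Open Scope ring_scope.

(* The matrix topology of MathComp-Analysis comes from the max norm, so the
   Euclidean length has to be defined separately. *)
Definition enorm (R : realType) (d : nat) (x : 'cV[R]_d) : R :=
  Num.sqrt (\sum_(i < d) x i 0 ^+ 2).

Definition intmx (R : pzRingType) (m n : nat) (A : 'M[int]_(m, n)) :
    'M[R]_(m, n) :=
  map_mx intr A.

Definition real_isotropic_dilation (R : realType) (d : nat) (A : 'M[int]_d) :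
    Prop :=
  let AC : 'M[R[i]]_d := intmx R[i] A in
  [/\ forall l, eigenvalue AC l -> 1 < `|l|,
      diagonalizable AC
    & forall l l', eigenvalue AC l -> eigenvalue AC l' -> `|l| = `|l'| ].

Definition orthogonalmx (R : realType) (d : nat) (U : 'M[R]_d) : Prop :=
  U^T *m U = 1%:M.

Definition sym_posdef (R : realType) (d : nat) (Q : 'M[R]_d) : Prop :=
  Q^T = Q /\ forall x : 'cV[R]_d, x != 0 -> 0 < (x^T *m Q *m x) 0 0.

Section Mask.
Variables (R : realType) (d : nat) (A : 'M[int]_d) (Q : 'M[R]_d).

Definition qdet : R := `|(\det A)%:~R|.

Definition invT : 'M[R]_d := invmx (intmx R A)^T.

Definition dilation_factorization (U : 'M[R]_d) : Prop :=
  [/\ orthogonalmx U, sym_posdef Q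
    & invT = (qdet `^ (- d%:R^-1)) *: (invmx Q *m U *m Q) ].

Definition G (xi : 'cV[R]_d) : R :=
  let q := Q *m Q in
  4 * (\sum_(i < d) q i i * sin (xi i 0 / 2) ^+ 2)
  + 2 * (\sum_(i < d) \sum_(j < d | (i < j)%N)
           q i j * sin (xi i 0) * sin (xi j 0)).

Definition digits : set 'cV[R]_d :=
  [set s : 'cV[R]_d | (forall i, 0 <= s i 0 < 1) /\
           exists k : 'cV[int]_d, (intmx R A)^T *m s = intmx R k].

(* [digits] is finite when A is invertible, so this finitely supported product
   ranges over all of its nonzero elements. *)
Definition m0 (xi : 'cV[R]_d) : R :=
  \big[*%R/1]_(s \in digits `\ 0)
    (G (xi + (2 * pi) *: s) / G ((2 * pi) *: s)).

Definition mu_quotient (xi : 'cV[R]_d) : R :=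
  qdet `^ (2 / d%:R) * m0 (invT *m xi) * G (invT *m xi) / G xi.

Definition mu (xi : 'cV[R]_d) : R :=
  if `[< exists k : 'cV[int]_d, xi = (2 * pi) *: intmx R k >]
  then lim (mu_quotient y @[y --> xi^'])
  else mu_quotient xi.

Definition M (xi : 'cV[R]_d) : R :=
  lim ((\prod_(0 <= j < n) mu (iter j (mulmx invT) xi)) @[n --> \oo]).

End Mask.

(* Main.v *)
Require Import Defs.
From HB Require Import structures.
From mathcomp Require Import all_boot all_order all_algebra.
From mathcomp Require Import complex ring lra.
From mathcomp Require Import all_classical all_reals all_analysis.

Set Implicit Arguments.
Unset Strict Implicit.
Unset Printing Implicit Defensive.

Import Order.TTheory GRing.Theory Num.Theory.
Import numFieldNormedType.Exports.

Local Open Scope classical_set_scope.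
Local Open Scope ring_scope.

(** Write B = A^{-T}, lam = q^{-1/d} < 1 and N x = |Q x|, and call 2 pi Z^d the
    lattice. Since B = lam Q^{-1} U Q with U orthogonal, N (B x) = lam * N x:
    in the norm N the map B is a similarity.

    The proof rests on the fact that mu = 1 on the lattice, so that applying
    A^T to a point that it sends into the lattice does not change M: the
    product for A^T x is the product for x preceded by the factor mu (A^T x) =
    1. For x = 2 pi (k + s) with s a nonzero digit, all the points (A^T)^n x
    with n > 0 lie in the lattice and N ((A^T)^n x) = lam^{-n} N x is
    unbounded, which yields the far points on which M takes the value M x.

    Why mu = 1 on the lattice. Up to a constant, m0 * G is the product of the
    translates of G by 2 pi times the digits, digit 0 included ([m0_mulG]); as
    the digits represent B Z^d / Z^d, this product is invariant under 2 pi B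
    Z^d ([GperiodizedD]). Hence xi |-> m0 (B xi) G (B xi) / G xi is
    lattice-periodic ([mu_quotientDlattice]), and its limit at every lattice
    point is its limit at 0. There m0 tends to 1 and G is equivalent to N ^ 2
    ([G_sub_sqr_Qnorm]), so that the limit of G (B xi) / G xi is lam ^ 2, which
    the factor q^{2/d} compensates ([cvg_mu_quotient]).

    Why M x > 0. Writing the sines of the double angles through half angles
    turns G into a sum of squares ([G_sum_of_squares]); thus G is positive off
    the lattice, and no factor vanishes along the orbit of a point off the
    lattice. The product of the mu (B^j x), j < n, telescopes to lam^{-2n} G
    (B^n x) / G x times the product of the m0 (B^{j+1} x) ([mu_partialE]). The
    first part tends to N x ^ 2 / G x; the second one has a positive limit
    because m0 is Lipschitz with m0 0 = 1 and N (B^j x) decays geometrically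
    ([cvg_prod_gt0]). *)

(** * The Euclidean norm *)

Section EuclideanNorm.
Variable R : realType.
Implicit Types d m : nat.

Lemma sqr_enorm d (x : 'cV[R]_d) : enorm x ^+ 2 = \sum_(i < d) x i 0 ^+ 2.
Proof. by rewrite /enorm sqr_sqrtr// sumr_ge0// => i _; exact: sqr_ge0. Qed.

Lemma enorm_ge0 d (x : 'cV[R]_d) : 0 <= enorm x.
Proof. exact: sqrtr_ge0. Qed.

Lemma sqr_enorm_mx d (x : 'cV[R]_d) : enorm x ^+ 2 = (x^T *m x) 0 0.
Proof. by rewrite sqr_enorm mxE; apply: eq_bigr => i _; rewrite mxE expr2. Qed.

Lemma enorm_entry d (x : 'cV[R]_d) i : `|x i 0| <= enorm x.
Proof.
rewrite -(@ler_pXn2r _ 2)// ?nnegrE ?enorm_ge0// sqr_enorm real_normK ?num_real//.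
by rewrite (bigD1 i)//= lerDl sumr_ge0// => j _; exact: sqr_ge0.
Qed.

Lemma enorm_eq0 d (x : 'cV[R]_d) : enorm x = 0 -> x = 0.
Proof.
move=> x0; apply/colP => i; apply/eqP; rewrite mxE -normr_le0 -x0.
exact: enorm_entry.
Qed.

Lemma enorm_gt0 d (x : 'cV[R]_d) : x != 0 -> 0 < enorm x.
Proof.
by move=> x0; rewrite lt_def enorm_ge0 andbT; apply: contraNneq x0 => /enorm_eq0->.
Qed.

Lemma enorm0 d : enorm (0 : 'cV[R]_d) = 0.
Proof. by rewrite /enorm big1 ?sqrtr0// => i _; rewrite mxE expr0n. Qed.

Lemma enormZ d (a : R) (x : 'cV[R]_d) : enorm (a *: x) = `|a| * enorm x.
Proof.
rewrite /enorm -sqrtr_sqr -sqrtrM ?sqr_ge0// mulr_sumr; congr Num.sqrt.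
by apply: eq_bigr => i _; rewrite mxE exprMn.
Qed.

Lemma enorm_orthogonal d (U : 'M[R]_d) (x : 'cV[R]_d) :
  orthogonalmx U -> enorm (U *m x) = enorm x.
Proof.
move=> hU; apply/eqP; rewrite -(@eqrXn2 _ 2) ?enorm_ge0// !sqr_enorm_mx.
by rewrite trmx_mul mulmxA -(mulmxA x^T) hU mulmx1.
Qed.

Lemma enorm_le_sum d (x : 'cV[R]_d) : enorm x <= \sum_i `|x i 0|.
Proof.
have s0 : 0 <= \sum_i `|x i 0| by rewrite sumr_ge0.
rewrite -(@ler_pXn2r _ 2)// ?nnegrE ?enorm_ge0// sqr_enorm expr2 mulr_suml.
apply: ler_sum => i _; rewrite -real_normK ?num_real// expr2 ler_wpM2l//.
by rewrite (bigD1 i)//= lerDl sumr_ge0.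
Qed.

Lemma enorm_le_bound d (x : 'cV[R]_d) (c : R) :
  (forall i, `|x i 0| <= c) -> enorm x <= d%:R * c.
Proof.
move=> xc; apply: (le_trans (enorm_le_sum x)).
apply: le_trans (_ : \sum_(i < d) c <= _); first exact: ler_sum.
by rewrite sumr_const card_ord mulr_natl.
Qed.

Lemma enorm_mulmx_le m d (P : 'M[R]_(m, d)) :
  exists2 C, 0 <= C & forall x : 'cV[R]_d, enorm (P *m x) <= C * enorm x.
Proof.
exists (\sum_i \sum_j `|P i j|) => [|x].
  by apply: sumr_ge0 => i _; exact: sumr_ge0.
apply: (le_trans (enorm_le_sum _)); rewrite mulr_suml; apply: ler_sum => i _.
rewrite mxE (le_trans (ler_norm_sum _ _ _))// mulr_suml; apply: ler_sum => j _.
by rewrite normrM ler_wpM2l// enorm_entry.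
Qed.

(** Factor each a_i^2 - b_i^2; every factor is an entry bounded by a norm, and there
    are [d] terms. *)
Lemma norm_sqr_enormB d (a b : 'cV[R]_d) :
  `|enorm a ^+ 2 - enorm b ^+ 2| <= d%:R * (enorm (a - b) * (enorm a + enorm b)).
Proof.
rewrite !sqr_enorm -sumrB (le_trans (ler_norm_sum _ _ _))//.
apply: le_trans (_ : \sum_(i < d) (enorm (a - b) * (enorm a + enorm b)) <= _).
  apply: ler_sum => i _; rewrite subr_sqr normrM ler_pM//.
    by have := enorm_entry (a - b) i; rewrite !mxE.
  by rewrite (le_trans (ler_normD _ _))// lerD// enorm_entry.
by rewrite sumr_const card_ord mulr_natl.
Qed.

End EuclideanNorm.

(** * Estimates and zeros of sine *)

Section Trigonometry.
Variable R : realType.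
Implicit Types x y a : R.

(** The intermediate point is located by its distance to [x], which avoids any case
    distinction on the order of [x] and [y]. *)
Lemma MVT_between (f df : R -> R) x y :
  (forall z : R, is_derive z 1 f (df z)) ->
  exists2 c, `|c - x| <= `|y - x| & f y - f x = df c * (y - x).
Proof.
move=> fdf.
have cf (u v : R) : {within `[u, v], continuous f}.
  apply: continuous_subspaceT => z; apply/differentiable_continuous.
  by apply/derivable1_diffP; case: (fdf z).
have [xy|/ltW yx] := leP x y.
  have [c] := @MVT_segment R f df _ _ xy (fun z _ => fdf z) (cf _ _).
  rewrite in_itv/= => /andP[xc cy] e; exists c => //.
  by rewrite !ger0_norm ?subr_ge0// lerB.
have [c] := @MVT_segment R f df _ _ yx (fun z _ => fdf z) (cf _ _).
rewrite in_itv/= => /andP[yc cx] e; exists c.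
  by rewrite !ler0_norm ?subr_le0// lerN2 lerB.
by rewrite -opprB e -mulrN opprB.
Qed.

Lemma lipschitz_sin x y : `|sin y - sin x| <= `|y - x|.
Proof.
have [c _ ->] := MVT_between x y (@is_derive_sin R).
by rewrite normrM ler_piMl// cos_max.
Qed.

Lemma lipschitz_cos x y : `|cos y - cos x| <= `|y - x|.
Proof.
have [c _ ->] := MVT_between x y (@is_derive_cos R).
by rewrite normrM normrN ler_piMl// sin_max.
Qed.

Lemma norm_sin_le x : `|sin x| <= `|x|.
Proof. by have := lipschitz_sin 0 x; rewrite sin0 !subr0. Qed.

(** By the mean value theorem sin x - x = (cos c - 1) x with |c| <= |x|, and
    |cos c - 1| <= |c|.  The quadratic order suffices to see that G is equivalent
    to its quadratic part at the origin. *)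
Lemma norm_sin_sub_id_le x : `|sin x - x| <= x ^+ 2.
Proof.
have dh (z : R) : is_derive z 1 (fun t : R => sin t - t) (cos z - 1).
  exact: is_deriveB.
have [c] := MVT_between 0 x dh.
rewrite sin0 !subr0 => cx ->; rewrite normrM -real_normK ?num_real// expr2.
rewrite ler_wpM2r// (le_trans _ cx)//.
by have := lipschitz_cos 0 c; rewrite cos0 subr0.
Qed.

Lemma sin_intpi (m : int) : sin (m%:~R * pi) = 0 :> R.
Proof.
have h (n : nat) : sin (n%:R * pi) = 0 :> R.
  elim: n => [|n ih]; first by rewrite mul0r sin0.
  by rewrite -addn1 natrD mulrDl mul1r sinDpi ih oppr0.
case: m => n; first exact: h.
by rewrite NegzE mulrNz mulNr sinN h oppr0.
Qed.

Lemma sqr_cos_intpi (m : int) : cos (m%:~R * pi) ^+ 2 = 1 :> R.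
Proof. by rewrite cos2sin2 sin_intpi expr0n subr0. Qed.

Lemma sqr_sinDintpi x (m : int) : sin (x + m%:~R * pi) ^+ 2 = sin x ^+ 2.
Proof. by rewrite sinD sin_intpi mulr0 addr0 exprMn sqr_cos_intpi mulr1. Qed.

Lemma sinD2intpi x (m : int) : sin (x + 2 * pi * m%:~R) = sin x.
Proof.
have -> : 2 * pi * m%:~R = m%:~R * pi + m%:~R * pi :> R by ring.
by rewrite sinD sinD cosD sin_intpi; have := sqr_cos_intpi m; rewrite expr2 => ->; ring.
Qed.

(** Subtracting the multiple of pi given by the integer part of x / pi brings [x]
    into [0, pi), where sine vanishes only at 0. *)
Lemma sin_eq0 x : sin x = 0 -> exists m : int, x = m%:~R * pi.
Proof.
move=> sx; have p0 := pi_gt0 R.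
exists (Num.floor (x / pi)); set m := Num.floor _; apply/eqP.
have /andP[h1 h2] : m%:~R * pi <= x < (m + 1)%:~R * pi.
  by rewrite -ler_pdivlMr// -ltr_pdivrMr// floor_itv// num_real.
rewrite eq_le h1 andbT leNgt; apply/negP => h3.
have : 0 < sin (x - m%:~R * pi).
  apply: sin_gt0_pi; rewrite subr_gt0 h3/=.
  by rewrite ltrBlDl -[X in _ + X]mul1r -mulrDl -intrD1.
by rewrite sinB sx sin_intpi mul0r mulr0 subr0 ltxx.
Qed.

End Trigonometry.

(** * The function G *)

Definition lattice (R : realType) d : set 'cV[R]_d :=
  [set x | exists k : 'cV[int]_d, x = (2 * pi) *: intmx R k].

Lemma sum_symmetric (R : realType) d (F : 'I_d -> 'I_d -> R) :
  (forall i j, F i j = F j i) ->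
  \sum_i \sum_j F i j =
  \sum_i F i i + 2 * \sum_(i < d) \sum_(j < d | (i < j)%N) F i j.
Proof.
move=> sF; set T := \sum_(i < d) \sum_(j < d | (i < j)%N) _.
have -> : \sum_i F i i + 2 * T = \sum_i F i i + T + T by ring.
have {2}-> : T = \sum_(i < d) \sum_(j < d | (j < i)%N) F i j.
  rewrite /T (exchange_big_dep xpredT)//=; apply: eq_bigr => i _.
  by apply: eq_bigr => j _; rewrite sF.
rewrite -!big_split/=; apply: eq_bigr => i _.
rewrite (bigD1 i)//= -addrA; congr (_ + _).
rewrite (bigID (fun j : 'I_d => (i < j)%N))/=; congr (_ + _); apply: eq_bigl => j.
  by rewrite -(inj_eq val_inj)/=; case: ltngtP.
by rewrite -(inj_eq val_inj)/=; case: ltngtP.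
Qed.

Section QuadraticMask.
Variables (R : realType) (d : nat) (Q : 'M[R]_d).
Hypothesis hQ : sym_posdef Q.
Implicit Types x y : 'cV[R]_d.

Local Notation N x := (enorm (Q *m x)).

Lemma sym_posdef_unitmx : Q \in unitmx.
Proof.
case: hQ => sQ pQ; rewrite -row_free_unit; apply: inj_row_free => v vQ.
apply/eqP; rewrite -(inj_eq (@trmx_inj _ _ _)) trmx0; apply/negPn/negP => /pQ.
by rewrite trmxK vQ mul0mx mxE ltxx.
Qed.

Let unitQ := sym_posdef_unitmx.

Lemma Qmul_inj x : Q *m x = 0 -> x = 0.
Proof. by move=> /(congr1 (mulmx (invmx Q))); rewrite mulKmx// mulmx0. Qed.

Lemma entry_le_Qnorm :
  exists2 C, 0 <= C & forall x i, `|x i 0| <= C * N x.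
Proof.
have [C C0 hC] := enorm_mulmx_le (invmx Q); exists C => // x i.
by rewrite (le_trans (enorm_entry x i))// -{1}(mulKmx unitQ x) hC.
Qed.

Lemma sqrmx_diag_gt0 i : 0 < (Q *m Q) i i.
Proof.
case: (hQ) => sQ _.
have -> : (Q *m Q) i i = N (delta_mx i 0 : 'cV[R]_d) ^+ 2.
  rewrite sqr_enorm_mx trmx_mul sQ -mulmxA (mulmxA Q) trmx_delta.
  by rewrite mulmxA -rowE -colE !mxE.
rewrite exprn_gt0// enorm_gt0//; apply/eqP => /Qmul_inj /matrixP/(_ i 0).
by rewrite !mxE !eqxx => /eqP; rewrite oner_eq0.
Qed.

Definition sinv x : 'cV[R]_d := \col_i sin (x i 0).

(** Follows from sin^2 t = 4 sin^2 (t / 2) - 4 sin^4 (t / 2) on the diagonal: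
    the terms without fourth powers are the quadratic form of Q^2 at the vector of
    sines. *)
Lemma G_sum_of_squares x :
  G Q x = N (sinv x) ^+ 2 + 4 * \sum_i (Q *m Q) i i * sin (x i 0 / 2) ^+ 4.
Proof.
case: (hQ) => sQ _; rewrite /G.
set q := Q *m Q.
have sq i j : q i j = q j i.
  have : q^T = q by rewrite /q trmx_mul sQ.
  by move=> /matrixP/(_ i j); rewrite mxE.
have -> : N (sinv x) ^+ 2 = \sum_i \sum_j q i j * sin (x i 0) * sin (x j 0).
  rewrite sqr_enorm_mx trmx_mul sQ -mulmxA (mulmxA Q) -/q mxE.
  apply: eq_bigr => i _; rewrite [_^T _ _]mxE [(q *m _) _ _]mxE mulr_sumr.
  by apply: eq_bigr => j _; rewrite ![sinv x _ _]mxE mulrA (mulrC (sin _)).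
rewrite sum_symmetric; last by move=> i j; rewrite (sq i j) mulrAC.
rewrite addrAC; congr (_ + _); rewrite !mulr_sumr -big_split/=.
apply: eq_bigr => i _; set t := x i 0 / 2.
have -> : x i 0 = t + t by rewrite /t; field.
rewrite sinD; have := cos2sin2 t; move: (sin t) (cos t) => u v h.
have -> : q i i * (u * v + v * u) * (u * v + v * u) =
    q i i * (4 * (u ^+ 2 * v ^+ 2)) by ring.
by rewrite h; ring.
Qed.

Lemma G_ge0 x : 0 <= G Q x.
Proof.
rewrite G_sum_of_squares addr_ge0 ?sqr_ge0// mulr_ge0// sumr_ge0// => i _.
by rewrite mulr_ge0 ?(ltW (sqrmx_diag_gt0 i))// (exprM _ 2 2) sqr_ge0.
Qed.

(** The entries of Q^2 on the diagonal being positive, every half-angle sine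
    vanishes with G. *)
Lemma G_eq0 x : G Q x = 0 -> lattice x.
Proof.
rewrite G_sum_of_squares => /eqP; rewrite paddr_eq0 ?sqr_ge0//; last first.
  rewrite mulr_ge0// sumr_ge0// => i _.
  by rewrite mulr_ge0 ?(ltW (sqrmx_diag_gt0 i))// (exprM _ 2 2) sqr_ge0.
move=> /andP[_]; rewrite mulf_eq0 pnatr_eq0/= psumr_eq0; last first.
  by move=> i _; rewrite mulr_ge0 ?(ltW (sqrmx_diag_gt0 i))// (exprM _ 2 2) sqr_ge0.
move=> /allP h.
have /choice[k hk] i : exists m : int, x i 0 = 2 * pi * m%:~R.
  have /sin_eq0[m hm] : sin (x i 0 / 2) = 0.
    have := h i (mem_index_enum i); rewrite /= mulf_eq0 gt_eqF ?sqrmx_diag_gt0//=.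
    by rewrite expf_eq0/= => /eqP.
  by exists m; rewrite -[LHS](@divfK _ 2) ?pnatr_eq0// hm; ring.
by exists (\col_i k i); apply/colP => i; rewrite !mxE.
Qed.

Lemma G_gt0 x : ~ lattice x -> 0 < G Q x.
Proof.
move=> nx; rewrite lt_def G_ge0 andbT; apply/eqP => /G_eq0; exact: nx.
Qed.

Lemma GDlattice x y : lattice y -> G Q (x + y) = G Q x.
Proof.
move=> [k ->]; rewrite /G; congr (4 * _ + 2 * _).
  apply: eq_bigr => i _; rewrite !mxE; congr (_ * _).
  have -> : (x i 0 + 2 * pi * (k i 0)%:~R) / 2 = x i 0 / 2 + (k i 0)%:~R * pi by field.
  by rewrite sqr_sinDintpi.
by apply: eq_bigr => i _; apply: eq_bigr => j _; rewrite !mxE !sinD2intpi.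
Qed.

(** In [G_sum_of_squares], replacing each sine by its argument in the first square
    costs a cubic error, and the sum of fourth powers is itself of higher order. *)
Lemma G_sub_sqr_Qnorm :
  exists2 K, 0 <= K & forall x, `|G Q x - N x ^+ 2| <= K * N x ^+ 3.
Proof.
have [C C0 hC] := entry_le_Qnorm.
have [D D0 hD] := enorm_mulmx_le Q.
have hv x : N (sinv x) <= D * d%:R * C * N x.
  apply: le_trans (hD _) _; rewrite -!mulrA ler_wpM2l// enorm_le_bound// => i.
  by rewrite mxE (le_trans (norm_sin_le _)).
have hw x : enorm (Q *m sinv x - Q *m x) <= D * d%:R * C ^+ 2 * N x ^+ 2.
  rewrite -mulmxBr; apply: le_trans (hD _) _.
  have -> : D * d%:R * C ^+ 2 * N x ^+ 2 = D * (d%:R * (C * N x) ^+ 2) by ring.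
  rewrite ler_wpM2l// enorm_le_bound// => i.
  rewrite !mxE (le_trans (norm_sin_sub_id_le _))//.
  by rewrite -real_normK ?num_real// lerXn2r// nnegrE// mulr_ge0// enorm_ge0.
pose q := \sum_i (Q *m Q) i i.
have q0 : 0 <= q by apply: sumr_ge0 => i _; exact/ltW/sqrmx_diag_gt0.
(* The first summand is the bound on |N (sinv x)^2 - N x^2|, the second one
   bounds the fourth powers. *)
exists (d%:R * (D * d%:R * C ^+ 2 * (D * d%:R * C + 1)) + 4 * (q * C ^+ 3)).
  by rewrite addr_ge0// !mulr_ge0// ?addr_ge0// ?mulr_ge0// ?exprn_ge0.
move=> x; rewrite G_sum_of_squares addrAC [leRHS]mulrDl.
apply: le_trans (ler_normD _ _) _; apply: lerD.
  apply: le_trans (norm_sqr_enormB _ _) _.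
  rewrite -!(mulrA d%:R) ler_wpM2l//.
  have -> : D * d%:R * C ^+ 2 * (D * d%:R * C + 1) * N x ^+ 3 =
     D * d%:R * C ^+ 2 * N x ^+ 2 * (D * d%:R * C * N x + N x) by ring.
  by rewrite ler_pM ?hw ?lerD ?hv ?addr_ge0 ?enorm_ge0.
rewrite normrM ger0_norm// -mulrA -(mulrA q) -exprMn ler_wpM2l// /q mulr_suml.
apply: le_trans (ler_norm_sum _ _ _) _; apply: ler_sum => i _.
have qi0 := ltW (sqrmx_diag_gt0 i).
rewrite normrM (ger0_norm qi0) ler_wpM2l//.
have s1 : `|sin (x i 0 / 2)| <= `|x i 0|.
  apply: le_trans (norm_sin_le _) _; rewrite normrM normfV (@ger0_norm _ 2)//.
  by have := normr_ge0 (x i 0); lra.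
rewrite normrX exprS; apply: le_trans (_ : `|sin (x i 0 / 2)| ^+ 3 <= _).
  by rewrite ler_piMl ?exprn_ge0// sin_max.
by rewrite lerXn2r ?nnegrE// ?mulr_ge0 ?enorm_ge0// (le_trans s1).
Qed.

End QuadraticMask.

(** * Bounded functions that are Lipschitz at the origin *)

Section BoundedLipschitz.
Variables (R : realType) (V : zmodType) (N : V -> R).
Hypothesis N_ge0 : forall x, 0 <= N x.
Implicit Types f g : V -> R.

(** Boundedness is part of the notion so that it is stable under products. *)
Definition bounded_lip f :=
  exists2 K, 0 <= K & forall x, `|f x| <= K /\ `|f x - f 0| <= K * N x.

Lemma bounded_lip_cst (a : R) : bounded_lip (fun=> a).
Proof. by exists `|a| => // x; rewrite subrr normr0 mulr_ge0. Qed.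

Lemma bounded_lipM f g :
  bounded_lip f -> bounded_lip g -> bounded_lip (fun x => f x * g x).
Proof.
move=> [K K0 hK] [L L0 hL]; exists (K * L + K * L) => [|x].
  by rewrite addr_ge0// mulr_ge0.
have [[f1 f2] [g1 g2]] := (hK x, hL x); have [g0 _] := hL 0; split.
  by rewrite normrM ler_wpDr ?mulr_ge0// ler_pM.
have -> : f x * g x - f 0 * g 0 = f x * (g x - g 0) + (f x - f 0) * g 0 by ring.
have -> : (K * L + K * L) * N x = K * (L * N x) + (K * N x) * L by ring.
by apply: le_trans (ler_normD _ _) _; rewrite !normrM lerD// ler_pM.
Qed.

Lemma bounded_lipD f g :
  bounded_lip f -> bounded_lip g -> bounded_lip (fun x => f x + g x).
Proof.
move=> [K K0 hK] [L L0 hL]; exists (K + L) => [|x]; first by rewrite addr_ge0.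
have [[f1 f2] [g1 g2]] := (hK x, hL x); split.
  by rewrite (le_trans (ler_normD _ _))// lerD.
rewrite opprD addrACA mulrDl; apply: le_trans (ler_normD _ _) _; exact: lerD.
Qed.

Lemma bounded_lip_sum I (r : seq I) (P : pred I) (F : I -> V -> R) :
  (forall i, bounded_lip (F i)) -> bounded_lip (fun x => \sum_(i <- r | P i) F i x).
Proof.
move=> hF; elim: r => [|i r ih].
  under [X in bounded_lip X]eq_fun do rewrite big_nil; exact: bounded_lip_cst.
under [X in bounded_lip X]eq_fun do rewrite big_cons.
by case: (P i) => //; apply: bounded_lipD.
Qed.

Lemma bounded_lip_prod I (r : seq I) (F : I -> V -> R) :
  (forall i, bounded_lip (F i)) -> bounded_lip (fun x => \prod_(i <- r) F i x).
Proof.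
move=> hF; elim: r => [|i r ih].
  under [X in bounded_lip X]eq_fun do rewrite big_nil; exact: bounded_lip_cst.
under [X in bounded_lip X]eq_fun do rewrite big_cons.
exact: bounded_lipM.
Qed.

Lemma bounded_lip_sin (c : R) (u : V -> R) (L : R) :
  0 <= L -> u 0 = 0 -> (forall x, `|u x| <= L * N x) ->
  bounded_lip (fun x => sin (u x + c)).
Proof.
move=> L0 u0 uL; exists (1 + L) => [|x]; first by rewrite addr_ge0.
split; first by rewrite ler_wpDr// sin_max.
apply: le_trans (lipschitz_sin _ _) _.
by rewrite u0 add0r addrK mulrDl mul1r ler_wpDl.
Qed.

End BoundedLipschitz.

Lemma bounded_lip_G (R : realType) d (Q : 'M[R]_d) (hQ : sym_posdef Q)
    (a : 'cV[R]_d) :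
  bounded_lip (fun x => enorm (Q *m x)) (fun x => G Q (x + a)).
Proof.
have N0 (x : 'cV[R]_d) : 0 <= enorm (Q *m x) by exact: enorm_ge0.
have [C C0 hC] := entry_le_Qnorm hQ.
have sl i : bounded_lip (fun x => enorm (Q *m x)) (fun x => sin ((x + a) i 0)).
  have h := bounded_lip_sin N0 (a i 0) (u := fun x : 'cV[R]_d => x i 0) C0.
  under [X in bounded_lip _ X]eq_fun do rewrite mxE.
  by apply: h => [|x]; rewrite ?mxE.
have sh i : bounded_lip (fun x => enorm (Q *m x)) (fun x => sin ((x + a) i 0 / 2)).
  have h := bounded_lip_sin N0 (a i 0 / 2) (u := fun x : 'cV[R]_d => x i 0 / 2) C0.
  under [X in bounded_lip _ X]eq_fun do rewrite mxE mulrDl.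
  apply: h => [|x]; rewrite ?mxE ?mul0r// normrM normfV (@ger0_norm _ 2)//.
  by have := hC x i; have := normr_ge0 (x i 0); lra.
have cst c := bounded_lip_cst N0 c.
rewrite /G; apply: bounded_lipD => //; apply: bounded_lipM => //.
  apply: bounded_lip_sum => // i; apply: bounded_lipM => //.
  by under [X in bounded_lip _ X]eq_fun do rewrite expr2; apply: bounded_lipM.
apply: bounded_lip_sum => // i; apply: bounded_lip_sum => // j.
apply: bounded_lipM => //; exact: bounded_lipM.
Qed.

(** * Convergent products with positive limit *)

Section InfiniteProducts.
Variable R : realType.

(** Both bounds come from ln b <= b - 1, applied to b = a and to b = a^-1. *)
Lemma norm_ln_le (a : R) : 0 < a -> `|ln a| <= (1 + a^-1) * `|a - 1|.
Proof.
move=> a0; have ai0 : 0 <= a^-1 by rewrite invr_ge0 ltW.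
have ln_le (b : R) : 0 < b -> ln b <= b - 1.
  by move=> b0; rewrite -{1}(subrKC 1 b) le_ln1Dx// ltrBrDl subrr.
have n0 := normr_ge0 (a - 1).
rewrite ler_norml mulrDl mul1r; apply/andP; split; last first.
  apply: le_trans (ln_le _ a0) _; rewrite ler_wpDr ?mulr_ge0//; exact: ler_norm.
rewrite lerNl -lnV ?posrE//; apply: le_trans (ln_le _ _) _; first by rewrite invr_gt0.
have -> : a^-1 - 1 = a^-1 * (1 - a) by rewrite mulrBr mulr1 mulVf// gt_eqF.
by rewrite ler_wpDl// ler_wpM2l// distrC ler_norm.
Qed.

Lemma cvg_to_of_norm_le T (F : set_system T) {FF : Filter F} (f g : T -> R) (l K : R) :
  g @ F --> 0 -> (\forall x \near F, `|f x - l| <= K * g x) -> f @ F --> l.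
Proof.
move=> g0 fg; apply/subr_cvg0; apply/norm_cvg0P.
apply: (@squeeze_cvgr _ _ _ _ (cst 0) (fun x => K * g x)) => //.
- by near=> x; rewrite normr_ge0/=; near: x.
- exact: cvg_cst.
- by rewrite -[X in _ --> X](mulr0 K); apply: cvgMr.
Unshelve. all: by end_near. Qed.

(** The inverses of the factors converge, hence are bounded, so that [norm_ln_le]
    dominates the logarithms by a geometric series; the limit is the exponential
    of the sum of this absolutely convergent series. *)
Lemma cvg_prod_gt0 (a : nat -> R) (K t : R) :
  0 <= t < 1 -> (forall n, 0 < a n) -> (forall n, `|a n - 1| <= K * t ^+ n) ->
  exists L : R, 0 < L /\ \prod_(0 <= j < n) a j @[n --> \oo] --> L.
Proof.
move=> /andP[t0 t1] a0 aK.
have tn : `|t| < 1 by rewrite ger0_norm.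
have a1 : a @ \oo --> (1 : R).
  apply: (@cvg_to_of_norm_le _ _ _ _ (geometric 1 t) _ K).
    exact: cvg_geometric.
  by apply: nearW => n; rewrite /geometric/= mul1r.
have ai1 : (fun n => (a n)^-1) @ \oo --> (1 : R)^-1 by apply: cvgV.
have [C hC] : exists C, forall n, (a n)^-1 <= C.
  have /cvg_seq_bounded[C [_ hC]] : cvgn (fun n => (a n)^-1).
    by apply/cvg_ex; exists 1^-1.
  exists (C + 1) => n; apply: le_trans (ler_norm _) _.
  by apply: hC => //; rewrite ltrDl.
have C0 : 0 <= 1 + C.
  by rewrite addr_ge0// (le_trans _ (hC 0%N))// invr_ge0 ltW.
have /normed_cvg/cvg_ex[/= l hl] : cvgn [normed series (fun n => ln (a n))].
  apply: (@series_le_cvg _ _ (geometric ((1 + C) * K) t)).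
  - by move=> n; exact: normr_ge0.
  - move=> n; rewrite /geometric/= -mulrA mulr_ge0//.
    by apply: le_trans (aK n).
  - move=> n; rewrite /geometric/= -mulrA; apply: le_trans (norm_ln_le (a0 n)) _.
    by rewrite ler_pM// ?addr_ge0 ?invr_ge0 ?(ltW (a0 n))// lerD2l.
  - exact: is_cvg_geometric_series.
exists (expR l); split; first exact: expR_gt0.
have -> : (fun n => \prod_(0 <= j < n) a j) = expR \o series (fun n => ln (a n)).
  apply/funext => n; rewrite /series/= expR_sum; apply: eq_bigr => j _.
  by rewrite lnK// posrE.
by apply: continuous_cvg => //; exact: continuous_expR.
Qed.

End InfiniteProducts.

(** * Integer vectors and fractional parts *)

Section IntegerVectors.
Variable R : realType.

Lemma intmxD m n (k l : 'M[int]_(m, n)) :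
  intmx R (k + l) = intmx R k + intmx R l.
Proof. exact: map_mxD. Qed.

Lemma intmxN m n (k : 'M[int]_(m, n)) : intmx R (- k) = - intmx R k.
Proof. exact: map_mxN. Qed.

Lemma intmx0 m n : intmx R (0 : 'M[int]_(m, n)) = 0.
Proof. exact: map_mx0. Qed.

Lemma tr_intmx_mul m n p (A : 'M[int]_(n, m)) (k : 'M[int]_(n, p)) :
  (intmx R A)^T *m intmx R k = intmx R (A^T *m k).
Proof. by rewrite /intmx map_trmx -map_mxM. Qed.

Lemma lattice_intmx d (k : 'cV[int]_d) : lattice ((2 * pi) *: intmx R k).
Proof. by exists k. Qed.

Lemma pi2_neq0 : 2 * pi != 0 :> R.
Proof. by rewrite mulf_neq0 ?gt_eqF ?pi_gt0. Qed.

Lemma lattice_scaleP d (y : 'cV[R]_d) :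
  lattice ((2 * pi) *: y) <-> exists k, y = intmx R k.
Proof.
by split=> -[k]; [move=> /(scalerI pi2_neq0) ->; exists k | move=> ->; exists k].
Qed.

Lemma latticeN d (x : 'cV[R]_d) : lattice x -> lattice (- x).
Proof. by move=> [k ->]; exists (- k); rewrite intmxN scalerN. Qed.

Lemma latticeD d (x y : 'cV[R]_d) : lattice x -> lattice y -> lattice (x + y).
Proof. by move=> [k ->] [l ->]; exists (k + l); rewrite intmxD scalerDr. Qed.

Definition fracv d (y : 'cV[R]_d) : 'cV[R]_d :=
  \col_i (y i 0 - (Num.floor (y i 0))%:~R).

Lemma fracvE d (y : 'cV[R]_d) : exists k : 'cV[int]_d, fracv y = y + intmx R k.
Proof.
exists (\col_i - Num.floor (y i 0)); apply/colP => i.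
by rewrite !mxE mulrNz.
Qed.

Lemma fracv_itv d (y : 'cV[R]_d) i : 0 <= fracv y i 0 < 1.
Proof.
by rewrite mxE subr_ge0 floor_le/= ltrBlDl -intrD1 floorD1_gt.
Qed.

Lemma fracvDint d (y : 'cV[R]_d) (k : 'cV[int]_d) : fracv (y + intmx R k) = fracv y.
Proof.
by apply/colP => i; rewrite !mxE floorDrz ?intr_int// intrKfloor intrD; ring.
Qed.

Lemma fracv_id d (y : 'cV[R]_d) : (forall i, 0 <= y i 0 < 1) -> fracv y = y.
Proof.
by move=> y01; apply/colP => i; rewrite mxE (@floor_def _ _ 0) ?subr0//.
Qed.

Lemma fsbig_prod_gt0 (I : choiceType) (S : set I) (F : I -> R) :
  finite_set S -> (forall i, S i -> 0 < F i) -> 0 < \big[*%R/1]_(i \in S) F i.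
Proof.
move=> fS F0; rewrite fsbig_finite// big_seq; apply: prodr_gt0 => i.
by rewrite in_fset_set// inE; exact: F0.
Qed.

End IntegerVectors.

(** * Digits and the mask *)

Section Digits.
Variables (R : realType) (d : nat) (A : 'M[int]_d) (Q : 'M[R]_d).
Hypothesis unitA : (intmx R A)^T \in unitmx.
Hypothesis hQ : sym_posdef Q.
Local Notation AT := ((intmx R A)^T).
Local Notation digitsA := (@digits R d A).
Local Notation N := (fun x : 'cV[R]_d => enorm (Q *m x)).

Lemma det_neq0 : \det A != 0.
Proof.
move: unitA; rewrite unitmxE det_tr /intmx det_map_mx unitfE.
by apply: contra_neq => ->.
Qed.

(** By Cramer's rule the entries of a digit are fractions with denominator
    |det A|, and they lie in [0, 1). *)
Lemma finite_digits : finite_set digitsA.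
Proof.
set n := absz (\det A).
pose f (g : {ffun 'I_d -> 'I_n.+1}) : 'cV[R]_d := \col_i ((g i)%:R / n%:R).
apply: (@sub_finite_set _ _ [set f g | g in [set: {ffun 'I_d -> 'I_n.+1}]]); last first.
  by apply: finite_image; exact: finite_finset.
move=> s [s01 [k sk]].
have ne : n%:R = `|(\det A)%:~R| :> R.
  by rewrite /n natr_absz intr_norm.
have n0 : 0 < n%:R :> R by rewrite ne normr_gt0 intr_eq0 det_neq0.
(* Multiply A^T s = k by the adjugate of A^T. *)
have [m hm] : exists m : 'cV[int]_d, (\det A)%:~R *: s = intmx R m.
  exists (\adj A^T *m k); have := congr1 (mulmx (\adj AT)) sk.
  rewrite mulmxA mul_adj_mx mul_scalar_mx det_tr /intmx det_map_mx map_mxM.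
  by rewrite map_mx_adj map_trmx.
have me i : s i 0 = (absz (m i 0))%:R / n%:R.
  have /andP[s0 _] := s01 i.
  have := congr1 (fun z : 'cV[R]_d => `|z i 0|) hm; rewrite !mxE normrM -ne.
  rewrite (ger0_norm s0) (natr_absz _ (m i 0)) intr_norm => <-.
  by rewrite mulrC mulKf// gt_eqF.
exists [ffun i => inord (absz (m i 0))] => //.
apply/colP => i; rewrite mxE ffunE me inordK// ltnS.
have /andP[_] := s01 i; rewrite me ltr_pdivrMr// mul1r ltr_nat.
exact: ltnW.
Qed.

Lemma digits0 : digitsA 0.
Proof.
split=> [i|]; first by rewrite mxE lexx ltr01.
by exists 0; rewrite mulmx0 intmx0.
Qed.

Lemma digit_notin_lattice s : (digitsA `\ 0) s -> ~ lattice ((2 * pi) *: s).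
Proof.
move=> [[s01 _] /= s0] /lattice_scaleP[k sk]; apply: s0.
rewrite -(fracv_id s01) -[s]add0r sk fracvDint fracv_id// => i.
by rewrite mxE lexx ltr01.
Qed.

(** The digits represent the quotient of { y | A^T y integral } by the integer
    vectors, on which translations act by bijections. *)
Lemma shift_digits_bij y : (exists k, AT *m y = intmx R k) ->
  set_bij digitsA digitsA (fun s => fracv (s + y)).
Proof.
have maps z : (exists k, AT *m z = intmx R k) ->
    forall s, digitsA s -> digitsA (fracv (s + z)).
  move=> [k zk] s [_ [l sl]]; split=> [i|]; first exact: fracv_itv.
  have [j ->] := fracvE (s + z).
  by exists (l + k + A^T *m j); rewrite !mulmxDr sl zk tr_intmx_mul !intmxD.
have canc z s : digitsA s -> fracv (fracv (s + z) - z) = s.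
  move=> [s01 _]; have [j ->] := fracvE (s + z).
  by rewrite addrAC addrK fracvDint fracv_id.
move=> [k yk].
have Nyk : exists k, AT *m (- y) = intmx R k.
  by exists (- k); rewrite mulmxN yk intmxN.
split.
- by apply: maps; exists k.
- move=> s t; rewrite !inE => hs ht e.
  by rewrite -(canc y _ hs) e canc.
- move=> t ht; exists (fracv (t - y)); first exact: maps.
  by have := canc (- y) t ht; rewrite opprK.
Qed.

(** Up to a constant this is m0 * G: the translate by the digit 0 is the factor G that
    is absent from m0. *)
Definition Gperiodized (x : 'cV[R]_d) : R :=
  \big[*%R/1]_(s \in digitsA) G Q (x + (2 * pi) *: s).

Lemma GperiodizedD x y : (exists k, AT *m y = intmx R k) ->
  Gperiodized (x + (2 * pi) *: y) = Gperiodized x.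
Proof.
move=> hy; rewrite /Gperiodized [RHS](reindex_fsbig _ _ _ _ (shift_digits_bij hy)).
(* Reduction modulo 1 moves the argument of G by a period. *)
apply: eq_fsbigr => s _; have [k ->] := fracvE (s + y).
have -> : x + (2 * pi) *: (s + y + intmx R k) =
    x + (2 * pi) *: y + (2 * pi) *: s + (2 * pi) *: intmx R k.
  by rewrite (addrC s) !scalerDr !addrA.
by rewrite [RHS]GDlattice//; exact: lattice_intmx.
Qed.

(** The normalizing constant of m0. *)
Definition Gdigits : R := \big[*%R/1]_(s \in digitsA `\ 0) G Q ((2 * pi) *: s).

Lemma finite_digitsD1 : finite_set (digitsA `\ 0).
Proof. by apply: finite_setD; exact: finite_digits. Qed.

Lemma Gdigits_gt0 : 0 < Gdigits.
Proof.
apply: fsbig_prod_gt0 => [|s hs]; first exact: finite_digitsD1.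
by apply: G_gt0 => //; exact: digit_notin_lattice.
Qed.

(** The product over the nonzero digits in m0 misses exactly the factor of the
    digit 0, which is G itself. *)
Lemma m0_mulG x : m0 A Q x * G Q x = Gperiodized x / Gdigits.
Proof.
apply: canRL (mulfK _) _; first by rewrite gt_eqF ?Gdigits_gt0.
rewrite /Gperiodized (fsbigD1 0)//; [|exact: finite_digits|exact: digits0].
rewrite scaler0 addr0 mulrAC mulrC; congr (_ * _).
rewrite /m0 /Gdigits -fsbig_split/=; last exact: finite_digitsD1.
apply: eq_fsbigr => s; rewrite inE => hs; rewrite divfK// gt_eqF// G_gt0//.
exact: digit_notin_lattice.
Qed.

Lemma m0_0 : m0 A Q 0 = 1.
Proof.
apply: fsbig1 => s hs; rewrite add0r divff// gt_eqF// G_gt0//.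
exact: digit_notin_lattice.
Qed.

Lemma m0_gt0 x :
  (forall s, (digitsA `\ 0) s -> ~ lattice (x + (2 * pi) *: s)) -> 0 < m0 A Q x.
Proof.
move=> hx; apply: fsbig_prod_gt0 => [|s hs]; first exact: finite_digitsD1.
by rewrite divr_gt0// G_gt0//; [exact: hx|exact: digit_notin_lattice].
Qed.

Lemma bounded_lip_m0 : bounded_lip N (m0 A Q).
Proof.
have N0 (x : 'cV[R]_d) : 0 <= N x by exact: enorm_ge0.
rewrite /m0; under [X in bounded_lip _ X]eq_fun do
  rewrite (fsbig_finite _ _ finite_digitsD1).
apply: bounded_lip_prod => // s; apply: bounded_lipM => //.
  exact: bounded_lip_G.
exact: bounded_lip_cst.
Qed.

End Digits.

(** * The determinant of a dilation *)

Section Dilation.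
Variables (R : realType) (d : nat) (A : 'M[int]_d).
Hypothesis hd : (0 < d)%N.
Hypothesis hA : real_isotropic_dilation R A.

(** The determinant is, up to sign, the product of the roots of the characteristic
    polynomial, all of modulus greater than 1; as d > 0 there is at least one. *)
Lemma qdet_gt1 : 1 < qdet R A.
Proof.
case: hA => big _ _; set AC := intmx R[i] A in big *.
have [r pr] := closed_field_poly_normal (char_poly AC).
rewrite (monicP (char_poly_monic _)) scale1r in pr.
have r1 z : z \in r -> 1 < `|z|.
  by move=> zr; apply: big; rewrite eigenvalue_root_char pr root_prod_XsubC.
have r0 : (0 < size r)%N.
  by have := size_char_poly AC; rewrite pr size_prod_XsubC => -[->].
have dC : `|(\det A)%:~R : R[i]| = \prod_(z <- r) `|z|.
  have /(congr1 (fun x : R[i] => `|x|)) := char_poly_det AC.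
  rewrite normrM normrX normrN1 expr1n mul1r /AC det_map_mx => <-.
  rewrite -horner_coef0 pr horner_prod normr_prod.
  by apply: eq_bigr => z _; rewrite !hornerE normrN.
have prod_gt1 : 1 < \prod_(z <- r) `|z|.
  case: r r0 r1 {pr dC} => // z r _ zr; rewrite big_cons.
  apply: lt_le_trans (zr z (mem_head _ _)) _; rewrite ler_peMr//.
  rewrite big_seq; elim/big_ind: _ => // [x y hx hy|x xr]; first exact: mulr_ege1.
  by apply/ltW/zr; rewrite in_cons xr orbT.
by move: prod_gt1; rewrite -dC -intr_norm ltr1z /qdet -intr_norm ltr1z.
Qed.

Lemma intmx_dilation_unit : (intmx R A)^T \in unitmx.
Proof.
rewrite unitmxE det_tr /intmx det_map_mx unitfE; apply/eqP => h.
by have := qdet_gt1; rewrite /qdet h normr0 ltr10.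
Qed.

End Dilation.

(** * Punctured neighborhoods of column vectors *)

Section PuncturedNeighborhoods.
Variables (R : realType) (d : nat).

Lemma cvg_enorm_mulmx m (P : 'M[R]_(m, d)) (x : 'cV[R]_d) :
  enorm (P *m (y - x)) @[y --> x^'] --> (0 : R).
Proof.
have [C C0 hC] := enorm_mulmx_le P.
apply/cvgrPdistC_le => e e0.
have c0 : 0 < C * d%:R + 1 by rewrite ltr_wpDl// mulr_ge0.
have h : \forall y \near x^', ball x (e / (C * d%:R + 1)) y.
  by apply: nbhs_dnbhs; apply: nbhsx_ballx; rewrite divr_gt0.
apply: filterS h => y [_ xy].
rewrite subr0 ger0_norm ?enorm_ge0//; apply: le_trans (hC _) _.
have hb : enorm (y - x) <= d%:R * (e / (C * d%:R + 1)).
  apply: enorm_le_bound => i; have := xy i 0; rewrite /ball/= => /ltW.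
  by rewrite !mxE distrC.
apply: le_trans (ler_wpM2l C0 hb) _.
by rewrite !mulrA ler_pdivrMr// mulrC ler_wpM2l ?(ltW e0)// lerDl.
Qed.

(** Without this, the limits that define mu on the lattice would not be unique; in
    dimension 0 a point has no punctured neighborhood. *)
Lemma dnbhs_cV_proper (hd : (0 < d)%N) (x : 'cV[R]_d) : ProperFilter x^'.
Proof.
apply: Build_ProperFilter => /nbhs_ballP[e /= e0 xe].
apply: (xe (x + const_mx (e / 2))).
  split=> // i j; rewrite !mxE /ball/= opprD addrA subrr sub0r normrN gtr0_norm.
    by rewrite ltr_pdivrMr// ltr_pMr// ltr1n.
  by rewrite divr_gt0.
apply/eqP => /colP/(_ (Ordinal hd))/eqP; rewrite !mxE -subr_eq0 addrAC subrr add0r.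
by rewrite gt_eqF// divr_gt0.
Qed.

End PuncturedNeighborhoods.

(** * The infinite product of mu along an orbit *)

Section MaskProduct.
Variables (R : realType) (d : nat) (A : 'M[int]_d) (U Q : 'M[R]_d).
Hypothesis hd : (0 < d)%N.
Hypothesis q_gt1 : 1 < qdet R A.
Hypothesis unitA : (intmx R A)^T \in unitmx.
Hypothesis hfact : dilation_factorization A Q U.
Implicit Types x y : 'cV[R]_d.

Local Notation AT := ((intmx R A)^T).
Local Notation B := (invT R A).
Local Notation N x := (enorm (Q *m x)).
Local Notation lam := (qdet R A `^ (- d%:R^-1)).

Let hQ : sym_posdef Q. Proof. by case: hfact. Qed.

Lemma lam_gt0 : 0 < lam.
Proof. by rewrite powR_gt0// (lt_trans ltr01). Qed.

Lemma lam_lt1 : lam < 1.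
Proof.
have q0 : 0 < qdet R A by exact: lt_trans q_gt1.
have di0 : 0 < d%:R^-1 :> R by rewrite invr_gt0 ltr0n.
have := gt0_ltr_powR di0 _ _ q_gt1; rewrite powR1 powRN invf_lt1 ?powR_gt0//.
by apply; rewrite nnegrE ?ler01// ltW.
Qed.

Lemma qdet_powR : qdet R A `^ (2 / d%:R) = lam ^- 2.
Proof.
have q0 : 0 <= qdet R A by exact/ltW/(lt_trans _ q_gt1).
rewrite powRN exprVn invrK -powR_mulrn ?powR_ge0// -powRrM mulrC.
by rewrite mulrC.
Qed.

Lemma mulBAT x : B *m (AT *m x) = x.
Proof. by rewrite /invT mulKmx. Qed.

Lemma mulATB x : AT *m (B *m x) = x.
Proof. by rewrite /invT mulKVmx. Qed.

(** The factorization conjugates B to lam times an isometry. *)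
Lemma Qnorm_invT x : N (B *m x) = lam * N x.
Proof.
case: hfact => hU hQ' ->.
rewrite -scalemxAl -scalemxAr enormZ gtr0_norm ?lam_gt0//; congr (_ * _).
rewrite -!mulmxA mulKVmx ?(sym_posdef_unitmx hQ)// mulmxA.
by rewrite -mulmxA enorm_orthogonal.
Qed.

Lemma Qnorm_gt0 x : x != 0 -> 0 < N x.
Proof.
by move=> x0; apply: enorm_gt0; apply: contra_neq x0 => /(Qmul_inj hQ).
Qed.

Lemma Qnorm_iter x n : N (iter n (mulmx B) x) = lam ^+ n * N x.
Proof.
by elim: n => [|n ih]; rewrite ?expr0 ?mul1r// iterS Qnorm_invT ih exprS mulrA.
Qed.

Lemma cvg_G_ratio T (F : set_system T) {FF : Filter F} (u : T -> 'cV[R]_d) :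
  (\forall t \near F, u t != 0) -> N (u t) @[t --> F] --> (0 : R) ->
  G Q (u t) / N (u t) ^+ 2 @[t --> F] --> (1 : R).
Proof.
move=> u0 Nu; have [K K0 hK] := G_sub_sqr_Qnorm hQ.
apply: (cvg_to_of_norm_le (K := K) Nu); apply: filterS u0 => t /Qnorm_gt0 n0.
have n2 : N (u t) ^+ 2 != 0 by rewrite expf_neq0// gt_eqF.
rewrite -[X in _ - X](divff n2) -mulrBl normrM normfV.
rewrite (@ger0_norm _ (_ ^+ 2)) ?sqr_ge0//.
by rewrite ler_pdivrMr ?exprn_gt0// -mulrA -exprS.
Qed.

Lemma cvg_m0 T (F : set_system T) {FF : Filter F} (u : T -> 'cV[R]_d) :
  N (u t) @[t --> F] --> (0 : R) -> m0 A Q (u t) @[t --> F] --> (1 : R).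
Proof.
move=> Nu; have [K K0 hK] := bounded_lip_m0 unitA hQ.
apply: (cvg_to_of_norm_le (K := K) Nu); apply: nearW => t.
by rewrite -(m0_0 A hQ); have [] := hK (u t).
Qed.

(** The numerator is the value at B x of a function invariant under 2 pi B Z^d, and
    the denominator is invariant under 2 pi Z^d. *)
Lemma mu_quotientDlattice x y : lattice y ->
  mu_quotient A Q (x + y) = mu_quotient A Q x.
Proof.
move=> ly; rewrite /mu_quotient GDlattice// -!(mulrA (_ `^ _)) !m0_mulG//.
case: ly => k ->; rewrite mulmxDr -scalemxAr GperiodizedD//.
by exists k; rewrite mulATB.
Qed.

(** By periodicity only the limit at the origin matters; there the quotient is the
    product of m0 (B u), of G / N^2 at B u and of the inverse of G / N^2 at u, as
    N (B u) = lam * N u absorbs q^{2/d} = lam^-2. *)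
Lemma cvg_mu_quotient x : lattice x -> mu_quotient A Q y @[y --> x^'] --> (1 : R).
Proof.
move=> lx; pose u y := y - x.
have Nu : N (u y) @[y --> x^'] --> (0 : R) by exact: cvg_enorm_mulmx.
have NBu : N (B *m u y) @[y --> x^'] --> (0 : R).
  under eq_fun do rewrite mulmxA; exact: cvg_enorm_mulmx.
have u0 : \forall y \near x^', u y != 0.
  by apply: filterS (nbhs_dnbhs_neq x) => y; rewrite /u subr_eq0.
have Bu0 : \forall y \near x^', B *m u y != 0.
  apply: filterS u0 => y; apply: contra_neq => h.
  by rewrite -(mulATB (u y)) h mulmx0.
have h : m0 A Q (B *m u y) * (G Q (B *m u y) / N (B *m u y) ^+ 2)
    * (G Q (u y) / N (u y) ^+ 2)^-1 @[y --> x^'] --> (1 * 1 * 1^-1 : R).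
  apply: cvgM; first by apply: cvgM; [exact: cvg_m0|exact: cvg_G_ratio].
  by apply: cvgV; [exact: oner_neq0|exact: cvg_G_ratio].
rewrite invr1 !mulr1 in h.
apply: cvg_trans h; apply: near_eq_cvg.
apply: filterS u0 => y uy.
rewrite -[in RHS](subrK x y) mu_quotientDlattice// -/(u y).
rewrite /mu_quotient qdet_powR Qnorm_invT /= exprMn !invfM invrK.
have n0 : N (u y) != 0 by rewrite gt_eqF// Qnorm_gt0.
have l0 : lam != 0 by rewrite gt_eqF// lam_gt0.
move: n0 l0; move: (N (u y)) lam (G Q (u y))^-1 => n l g n0 l0 /=.
by field; rewrite l0 n0.
Qed.

Lemma mu_lattice x : lattice x -> mu A Q x = 1.
Proof.
move=> lx; rewrite /mu asboolT//; apply: cvg_lim; first exact: Rhausdorff.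
- exact: dnbhs_cV_proper.
- exact: cvg_mu_quotient.
Qed.

Lemma mu_notin_lattice x : ~ lattice x -> mu A Q x = mu_quotient A Q x.
Proof. by move=> lx; rewrite /mu asboolF. Qed.

Lemma lattice_mulAT x : lattice x -> lattice (AT *m x).
Proof. by move=> [k ->]; exists (A^T *m k); rewrite -scalemxAr tr_intmx_mul. Qed.

(** The integer matrix A^T maps the lattice into itself, so that x is in the lattice
    as soon as some B^n x is. *)
Lemma iter_notin_lattice x n : ~ lattice x -> ~ lattice (iter n (mulmx B) x).
Proof.
move=> lx; elim: n => //= n ih /lattice_mulAT; rewrite mulATB; exact: ih.
Qed.

(** A zero of m0 at B x would make B x + 2 pi s a lattice point for some digit [s];
    applying A^T, x itself would be one. *)
Lemma m0_invT_gt0 x : ~ lattice x -> 0 < m0 A Q (B *m x).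
Proof.
move=> lx; apply: m0_gt0 => // s [[_ [k sk]] _] /lattice_mulAT h; apply: lx.
move: h; rewrite mulmxDr mulATB -scalemxAr sk => h.
rewrite -(addrK ((2 * pi) *: intmx R k) x); apply: latticeD => //.
by apply: latticeN; exact: lattice_intmx.
Qed.

Definition mu_partial x n : R := \prod_(0 <= j < n) mu A Q (iter j (mulmx B) x).

(** In each factor mu (B^j x) = lam^-2 m0 (B^{j+1} x) G (B^{j+1} x) / G (B^j x) the
    values of G telescope. *)
Lemma mu_partialE x n : ~ lattice x ->
  mu_partial x n =
  lam ^- (2 * n) * G Q (iter n (mulmx B) x) / G Q x
  * \prod_(0 <= j < n) m0 A Q (iter j.+1 (mulmx B) x).
Proof.
move=> lx; rewrite /mu_partial; elim: n => [|n ih].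
  rewrite !big_geq// muln0 expr0 invr1 mul1r mulr1 divff// gt_eqF//.
  exact: G_gt0.
rewrite !big_nat_recr//= ih mu_notin_lattice; last exact: iter_notin_lattice.
rewrite /mu_quotient qdet_powR.
have g0 : G Q (iter n (mulmx B) x) != 0.
  by rewrite gt_eqF// G_gt0//; exact: iter_notin_lattice.
have l0 : lam != 0 by rewrite gt_eqF// lam_gt0.
rewrite mulnS exprD; field.
by rewrite g0 l0 expf_neq0// gt_eqF// G_gt0.
Qed.

Lemma cvg_mu_partial x : ~ lattice x ->
  exists L : R, 0 < L /\ mu_partial x n @[n --> \oo] --> L.
Proof.
move=> lx.
have x0 : x != 0.
  by apply/eqP => x0; apply: lx; exists 0; rewrite x0 intmx0 scaler0.
have [K K0 hK] := bounded_lip_m0 unitA hQ.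
have lam01 : 0 <= lam < 1 by rewrite (ltW lam_gt0) lam_lt1.
have [L [L0 hL]] : exists L : R, 0 < L /\
    \prod_(0 <= j < n) m0 A Q (iter j.+1 (mulmx B) x) @[n --> \oo] --> L.
  apply: (@cvg_prod_gt0 _ _ (K * (lam * N x)) lam) => // n.
    by rewrite iterS; apply: m0_invT_gt0; exact: iter_notin_lattice.
  have [_] := hK (iter n.+1 (mulmx B) x); rewrite (m0_0 A hQ) Qnorm_iter exprS.
  by rewrite (mulrAC lam) mulrA.
have Nx := Qnorm_gt0 x0.
exists (N x ^+ 2 / G Q x * L); split.
  by rewrite !mulr_gt0// ?exprn_gt0// invr_gt0 G_gt0.
have NB : N (iter n (mulmx B) x) @[n --> \oo] --> (0 : R).
  under eq_fun do rewrite Qnorm_iter mulrC.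
  by apply: cvg_geometric; rewrite gtr0_norm ?lam_gt0 ?lam_lt1.
have B0 : \forall n \near \oo, iter n (mulmx B) x != 0.
  apply: nearW => n; apply/eqP => h; have := Qnorm_iter x n.
  rewrite h /= mulmx0 enorm0 => /esym/eqP.
  by rewrite mulf_eq0 expf_eq0 !gt_eqF ?lam_gt0// andbF.
have h : G Q (iter n (mulmx B) x) / N (iter n (mulmx B) x) ^+ 2
    * (N x ^+ 2 / G Q x) * \prod_(0 <= j < n) m0 A Q (iter j.+1 (mulmx B) x)
    @[n --> \oo] --> 1 * (N x ^+ 2 / G Q x) * L.
  by apply: cvgM => //; apply: cvgM; [exact: cvg_G_ratio|exact: cvg_cst].
rewrite mul1r in h; apply: cvg_trans h; apply: near_eq_cvg; apply: nearW => n /=.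
rewrite mu_partialE//; congr (_ * _); rewrite Qnorm_iter exprMn -exprM mulnC.
have n2 : N x != 0 by rewrite gt_eqF.
have l0 : lam ^+ (2 * n) != 0 by rewrite expf_neq0// gt_eqF// lam_gt0.
move: n2 l0; move: (N x) (lam ^+ (2 * n)) (G Q x)^-1 => m l g n0 l0.
by field; rewrite l0 n0.
Qed.

(** The first factor is mu at a lattice point, and the others are those of [x] since
    B A^T = 1. *)
Lemma mu_partial_mulAT x n : lattice (AT *m x) ->
  mu_partial (AT *m x) n.+1 = mu_partial x n.
Proof.
move=> lx; rewrite /mu_partial big_nat_recl//= mu_lattice// mul1r.
by apply: eq_bigr => j _; rewrite -iterS iterSr mulBAT.
Qed.

Lemma cvg_mu_partial_iter x (L : R) n : lattice (AT *m x) ->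
  mu_partial x m @[m --> \oo] --> L ->
  mu_partial (iter n (mulmx AT) x) m @[m --> \oo] --> L.
Proof.
move=> lx hL; elim: n => [//|n ih]; rewrite iterS.
have ln : lattice (AT *m iter n (mulmx AT) x).
  elim: n {ih} => [//|n ih]; rewrite iterS; exact: lattice_mulAT.
rewrite -cvg_shiftS; apply: cvg_trans ih; apply: near_eq_cvg; apply: nearW => m.
by rewrite /= mu_partial_mulAT.
Qed.

Lemma iter_mulAT_unbounded x (r : R) : x != 0 ->
  exists n, r < enorm (iter n (mulmx AT) x).
Proof.
move=> x0; have [C C0 hC] := enorm_mulmx_le Q.
have NA n : lam ^+ n * N (iter n (mulmx AT) x) = N x.
  rewrite -Qnorm_iter; congr (enorm (_ *m _)).
  by elim: n => //= n ih; rewrite -iterS iterSr mulBAT.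
have : (geometric (C * r) lam) @ \oo --> (0 : R).
  by apply: cvg_geometric; rewrite gtr0_norm ?lam_gt0 ?lam_lt1.
move=> /cvgr_lt/(_ _ (Qnorm_gt0 x0))[n _ /(_ n (leqnn n)) /=].
rewrite /geometric/= -(NA n) mulrC ltr_pM2l ?exprn_gt0 ?lam_gt0// => h.
exists n; have := lt_le_trans h (hC _).
by move=> {}h; rewrite ltNge; apply: contraTN h => h; rewrite -leNgt ler_wpM2l.
Qed.

End MaskProduct.

(** * Far points with the same value of M *)

Theorem theorem3p8 (R : realType) (d : nat) (hd : (0 < d)%N)
    (A : 'M[int]_d) (hA : real_isotropic_dilation R A)
    (U Q : 'M[R]_d) (hQ : dilation_factorization A Q U)
    (k : 'cV[int]_d) (s : 'cV[R]_d) (hs : (digits A `\ 0) s)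
    (r : R) (hr : enorm ((2 * pi) *: (intmx R k + s)) < r) :
  exists xi : 'cV[R]_d,
    [/\ r < enorm xi,
        M A Q xi = M A Q ((2 * pi) *: (intmx R k + s))
      & 0 < M A Q ((2 * pi) *: (intmx R k + s)) ].
Proof.
set x := (2 * pi) *: _.
have q1 := qdet_gt1 hd hA; have uA := intmx_dilation_unit hd hA.
have lx : ~ lattice x.
  move=> h; apply: (digit_notin_lattice hs).
  have -> : (2 * pi) *: s = x + - ((2 * pi) *: intmx R k).
    by rewrite /x scalerDr addrAC subrr add0r.
  by apply: latticeD => //; apply: latticeN; exact: lattice_intmx.
have x0 : x != 0.
  by apply/eqP => x0; apply: lx; exists 0; rewrite x0 intmx0 scaler0.
have lAx : lattice ((intmx R A)^T *m x).
  case: hs => -[_ [l sl]] _; rewrite /x -scalemxAr mulmxDr sl tr_intmx_mul -intmxD.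
  exact: lattice_intmx.
have [L [L0 hL]] := cvg_mu_partial hd q1 uA hQ lx.
have [n hn] := iter_mulAT_unbounded hd q1 uA hQ r x0.
have Mx : M A Q x = L by apply: cvg_lim hL; exact: Rhausdorff.
exists (iter n (mulmx (intmx R A)^T) x); split=> //; last by rewrite Mx.
rewrite Mx; apply: cvg_lim; first exact: Rhausdorff.
exact: (cvg_mu_partial_iter hd q1 uA hQ n lAx hL).
Qed.
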